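(* $$\frac{8}{54G-49}=\mathrm{CF}\left[3n^2+15n+19,\,-2n(n+2)^3\right],$$ where $G$ is Catalan's constant.
   Context: For sequences $(a_n)_{n\ge0}$, $(b_n)_{n\ge1}$, $\mathrm{CF}[a_n,b_n]$ denotes the continued fraction $a_0+\cfrac{b_1}{a_1+\cfrac{b_2}{a_2+\ddots}}$, whose value is $\lim_{n\to\infty}A_n/B_n$, where $A_0=1$, $A_1=a_0$, $B_0=0$, $B_1=1$, and $A_{n+1}=a_nA_n+b_nA_{n-1}$, $B_{n+1}=a_nB_n+b_nB_{n-1}$ for $n\ge1$. Catalan's constant is $G=\sum_{k=0}^\infty \frac{(-1)^k}{(2k+1)^2}$. *)

(* Defs.v *)
From Stdlib Require Import Reals.
From Coquelicot Require Import Coquelicot.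
Open Scope R_scope.

(* CF[a_n, b_n] is given by a : nat -> R and b : nat -> R; the value b 0 is
   never used. *)
Fixpoint CF_num (a b : nat -> R) (n : nat) : R :=
  match n with
  | O => 1
  | S m => match m with
           | O => a O
           | S k => a m * CF_num a b m + b m * CF_num a b k
           end
  end.

Fixpoint CF_den (a b : nat -> R) (n : nat) : R :=
  match n with
  | O => 0
  | S m => match m with
           | O => 1
           | S k => a m * CF_den a b m + b m * CF_den a b k
           end
  end.

(* Division by zero is total here and [CF_den a b 0 = 0], so we ask that the
   convergents be genuine quotients from some rank on. *)
Definition is_CF (a b : nat -> R) (l : R) : Prop :=
  eventually (fun n => CF_den a b n <> 0) /\
  is_lim_seq (fun n => CF_num a b n / CF_den a b n) (Finite l).

Definition Catalan : R :=
  Series (fun k => (-1) ^ k / (2 * INR k + 1) ^ 2).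

(* Main.v *)
Require Import Defs.
From Stdlib Require Import Reals Factorial Lra Lia.
From Coquelicot Require Import Coquelicot.
Open Scope R_scope.

(* With K the complete elliptic integral of the first kind as a function of
   the modulus, the numbers v_n = int_0^1 (1-x)^n K(x) dx satisfy v_0 = 2 G,
   v_1 = 2 G - 1 and
     (n+1)^2 v_(n+1) = (3n^2+3n+1) v_n - 2n^2 v_(n-1)   for n >= 1.
   A combination of v_n and v_(n+1) with polynomial coefficients, times
   (n+1)!^2, satisfies the recurrence of the continued fraction and equals
   (54 G - 49) A_n - 8 B_n by comparison of the first two values.  Since v_n is
   bounded whereas B_n/n!^2 grows exponentially, this linear form is o(B_n).

   No integral is needed: integrating the power series of K termwise gives
     v_n = (pi/2) sum_l h_l n! / ((2l+1)(2l+2)...(2l+n+1)),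
     h_l = (binomial(2l,l) / 4^l)^2,
   and all identities follow by telescoping in l (Zeilberger, WZ).  The constant
   2/pi only enters as the limit of 2 l h_l. *)

(** * Squared Wallis ratios and the limit of [2 * INR l * wallis_sq l] *)

Fixpoint wallis_sq (l : nat) : R :=
  match l with
  | O => 1
  | S m => wallis_sq m * ((2 * INR m + 1) / (2 * INR m + 2)) ^ 2
  end.

Lemma wallis_sq_pos (l : nat) : 0 < wallis_sq l.
Proof.
  induction l as [|l IH]; cbn [wallis_sq]; [lra|].
  apply Rmult_lt_0_compat; [exact IH|].
  pose proof (pos_INR l). apply pow_lt, Rdiv_lt_0_compat; lra.
Qed.

(** Consecutive left-hand sides have ratio (2l+3)(2l+1)/(2l+2)^2 <= 1, and the first one is 1. *)
Lemma wallis_sq_le (l : nat) : (2 * INR l + 1) * wallis_sq l <= 1.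
Proof.
  induction l as [|l IH]; [simpl; lra|].
  cbn [wallis_sq]. rewrite S_INR. pose proof (pos_INR l) as Hl.
  pose proof (wallis_sq_pos l) as Hh.
  replace ((2 * (INR l + 1) + 1) * (wallis_sq l * ((2 * INR l + 1) / (2 * INR l + 2)) ^ 2))
    with ((2 * INR l + 1) * wallis_sq l *
          (((2 * INR l + 3) * (2 * INR l + 1)) / (2 * INR l + 2) ^ 2)) by (field; lra).
  assert (0 <= ((2 * INR l + 3) * (2 * INR l + 1)) / (2 * INR l + 2) ^ 2 <= 1).
  { split.
    - apply Rlt_le, Rdiv_lt_0_compat; nra.
    - apply Rle_div_l; nra. }
  assert (0 <= (2 * INR l + 1) * wallis_sq l) by nra.
  nra.
Qed.

Lemma wallis_sq_step (l : nat) :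
  wallis_sq l / (2 * INR l + 2) =
  2 * INR (S l) * wallis_sq (S l) - 2 * INR l * wallis_sq l.
Proof.
  cbn [wallis_sq]. rewrite S_INR. pose proof (pos_INR l). field. lra.
Qed.

Definition wallis_lim : R := real (Lim_seq (fun l => 2 * INR l * wallis_sq l)).

(** Monotone convergence: increments are positive by [wallis_sq_step], and [wallis_sq_le] bounds the
    terms by 1. *)
Lemma wallis_sq_lim :
  is_lim_seq (fun l => 2 * INR l * wallis_sq l) wallis_lim.
Proof.
  apply Lim_seq_correct'.
  apply ex_finite_lim_seq_incr with 1.
  - intros l. pose proof (wallis_sq_step l) as H.
    pose proof (wallis_sq_pos l). pose proof (pos_INR l).
    assert (0 < wallis_sq l / (2 * INR l + 2)) by (apply Rdiv_lt_0_compat; lra).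
    lra.
  - intros l. pose proof (wallis_sq_le l). pose proof (wallis_sq_pos l). lra.
Qed.

(** Carries every telescoping below: [g] is the certificate, and its limit is the sum. *)
Lemma is_series_telescope (a g : nat -> R) (L : R) :
  (forall l, a l = g (S l) - g l) -> g O = 0 -> is_lim_seq g L -> is_series a L.
Proof.
  intros Ha H0 Hg.
  assert (Hs : forall n, sum_n a n = g (S n)).
  { induction n as [|n IH].
    - rewrite sum_O, Ha. lra.
    - rewrite sum_Sn, IH, Ha. unfold plus; simpl. lra. }
  apply (is_lim_seq_ext (fun n => g (S n)) (sum_n a) L).
  - intros n. symmetry. apply Hs.
  - apply (is_lim_seq_incr_1 g L), Hg.
Qed.

Lemma wallis_sq_series :
  is_series (fun l => wallis_sq l / (2 * INR l + 2)) wallis_lim.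
Proof.
  apply (is_series_telescope _ (fun l => 2 * INR l * wallis_sq l)).
  - apply wallis_sq_step.
  - simpl. ring.
  - apply wallis_sq_lim.
Qed.

Lemma Series_nonneg (a : nat -> R) :
  (forall n, 0 <= a n) -> ex_series a -> 0 <= Series a.
Proof.
  intros Ha Hs. rewrite <- (Rmult_0_l (Series a)), <- Series_scal_l.
  apply Series_le; [|exact Hs].
  intros n. specialize (Ha n). lra.
Qed.

Lemma wallis_lim_pos : 0 < wallis_lim.
Proof.
  pose proof wallis_sq_series as H.
  apply is_series_unique in H as H'.
  assert (Hp : forall l, 0 < wallis_sq l / (2 * INR l + 2)).
  { intros l. pose proof (wallis_sq_pos l). pose proof (pos_INR l).
    apply Rdiv_lt_0_compat; lra. }
  rewrite <- H', Series_incr_1 by (eexists; exact H).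
  apply Rplus_lt_le_0_compat; [apply Hp|].
  apply Series_nonneg.
  - intros n. apply Rlt_le, Hp.
  - apply (ex_series_incr_1 (fun l => wallis_sq l / (2 * INR l + 2))).
    eexists; exact H.
Qed.

(** * Moments: convergence and three-term recurrence *)

(* [moment n] is wallis_lim * v_n. *)
Fixpoint moment_term (n l : nat) : R :=
  match n with
  | O => wallis_sq l / (2 * INR l + 1)
  | S m => moment_term m l * ((INR m + 1) / (2 * INR l + INR m + 2))
  end.

Definition moment (n : nat) : R := Series (moment_term n).

Lemma moment_term_pos (n l : nat) : 0 < moment_term n l.
Proof.
  pose proof (pos_INR l).
  induction n as [|n IH]; cbn [moment_term].
  - apply Rdiv_lt_0_compat; [apply wallis_sq_pos|lra].
  - pose proof (pos_INR n). apply Rmult_lt_0_compat; [exact IH|].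
    apply Rdiv_lt_0_compat; lra.
Qed.

Lemma moment_term_decr (n l : nat) : moment_term (S n) l <= moment_term n l.
Proof.
  cbn [moment_term]. pose proof (moment_term_pos n l).
  pose proof (pos_INR l). pose proof (pos_INR n).
  assert ((INR n + 1) / (2 * INR l + INR n + 2) <= 1) by (apply Rle_div_l; lra).
  nra.
Qed.

Lemma moment_term_le_0 (n l : nat) : moment_term n l <= moment_term O l.
Proof.
  induction n as [|n IH]; [lra|].
  eapply Rle_trans; [apply moment_term_decr|exact IH].
Qed.

Lemma ex_series_moment_term_0 : ex_series (moment_term O).
Proof.
  apply (ex_series_le (K := R_AbsRing) (V := R_CompleteNormedModule)
           _ (fun l => 2 * (wallis_sq l / (2 * INR l + 2)))).
  - intros l. change (Rabs (moment_term O l) <= 2 * (wallis_sq l / (2 * INR l + 2))).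
    rewrite Rabs_pos_eq by apply Rlt_le, moment_term_pos.
    cbn [moment_term]. pose proof (pos_INR l). pose proof (wallis_sq_pos l).
    replace (2 * (wallis_sq l / (2 * INR l + 2))) with (wallis_sq l / (INR l + 1))
      by (field; lra).
    apply Rmult_le_compat_l; [lra|]. apply Rinv_le_contravar; lra.
  - apply (ex_series_scal_l 2 (fun l => wallis_sq l / (2 * INR l + 2))). eexists. apply wallis_sq_series.
Qed.

Lemma ex_series_moment_term (n : nat) : ex_series (moment_term n).
Proof.
  apply (ex_series_le (K := R_AbsRing) (V := R_CompleteNormedModule)
           _ (moment_term O)); [|apply ex_series_moment_term_0].
  intros l. change (Rabs (moment_term n l) <= moment_term O l).
  rewrite Rabs_pos_eq by apply Rlt_le, moment_term_pos.
  apply moment_term_le_0.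
Qed.

Lemma moment_nonneg (n : nat) : 0 <= moment n.
Proof.
  apply Series_nonneg; [|apply ex_series_moment_term].
  intros l. apply Rlt_le, moment_term_pos.
Qed.

Lemma moment_decr (n : nat) : moment (S n) <= moment n.
Proof.
  apply Series_le; [|apply ex_series_moment_term].
  intros l. split; [apply Rlt_le, moment_term_pos|apply moment_term_decr].
Qed.

Lemma moment_le_0 (n : nat) : moment n <= moment O.
Proof.
  induction n as [|n IH]; [lra|].
  eapply Rle_trans; [apply moment_decr|exact IH].
Qed.

(** Partial fractions: 1/((2l+1)(2l+2)) = 1/(2l+1) - 1/(2l+2), and the second part sums to
    [wallis_lim]. *)
Lemma moment_1 : moment 1 = moment 0 - wallis_lim.
Proof.
  unfold moment. rewrite <- (is_series_unique _ _ wallis_sq_series).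
  rewrite <- Series_minus.
  - apply Series_ext. intros l. simpl. pose proof (pos_INR l). field. lra.
  - apply ex_series_moment_term.
  - eexists. apply wallis_sq_series.
Qed.

(** The hypergeometric ratio in l; with the ratio in n from the definition it reduces the
    telescoping in [moment_rec] to an identity of rational functions. *)
Lemma moment_term_shift (n l : nat) :
  (2 * INR l + 2) * (2 * INR l + INR n + 2) * (2 * INR l + INR n + 3)
    * moment_term n (S l)
  = (2 * INR l + 1) ^ 3 * moment_term n l.
Proof.
  pose proof (pos_INR l).
  induction n as [|n IH].
  - cbn [moment_term]. cbn [wallis_sq]. rewrite S_INR. simpl INR. field. lra.
  - cbn [moment_term]. rewrite !S_INR. pose proof (pos_INR n).
    transitivity ((INR n + 1) / (2 * INR l + INR n + 2) *
      ((2 * INR l + 2) * (2 * INR l + INR n + 2) * (2 * INR l + INR n + 3)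
         * moment_term n (S l))).
    + field. lra.
    + rewrite IH. field. lra.
Qed.

Lemma lim_mul_moment_term (n : nat) :
  is_lim_seq (fun l => INR l * moment_term n l) 0.
Proof.
  apply is_lim_seq_le_le with (fun _ => 0) (fun l => / INR (S l)).
  - intros l. pose proof (pos_INR l). pose proof (moment_term_pos n l).
    split; [nra|].
    apply Rle_trans with (INR l * moment_term O l).
    { apply Rmult_le_compat_l; [lra|apply moment_term_le_0]. }
    cbn [moment_term]. rewrite S_INR. pose proof (wallis_sq_le l).
    pose proof (wallis_sq_pos l).
    replace (INR l * (wallis_sq l / (2 * INR l + 1)))
      with (INR l * wallis_sq l / (2 * INR l + 1)) by (field; lra).
    apply Rle_div_l; [lra|].
    apply Rle_trans with 1; [nra|].
    apply Rmult_le_reg_l with (INR l + 1); [lra|].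
    rewrite <- Rmult_assoc, Rinv_r by lra. lra.
  - apply is_lim_seq_const.
  - apply (is_lim_seq_incr_1 (fun n => / INR n) 0).
    replace (Finite 0) with (Rbar_inv p_infty) by reflexivity.
    apply is_lim_seq_inv; [apply is_lim_seq_INR|discriminate].
Qed.

Lemma moment_rec (n : nat) :
  (INR n + 2) ^ 2 * moment (S (S n)) =
  (3 * (INR n + 1) ^ 2 + 3 * (INR n + 1) + 1) * moment (S n)
  - 2 * (INR n + 1) ^ 2 * moment n.
Proof.
  set (c := 3 * (INR n + 1) ^ 2 + 3 * (INR n + 1) + 1).
  assert (H : is_series (fun l => (INR n + 2) ^ 2 * moment_term (S (S n)) l
                 - c * moment_term (S n) l + 2 * (INR n + 1) ^ 2 * moment_term n l) 0).
  (* Zeilberger certificate: it vanishes at l = 0 by its factor l, and at infinity by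
     [lim_mul_moment_term]. *)
  { apply (is_series_telescope _
             (fun l => - 2 * (INR n + 1) * (INR l * moment_term n l))).
    - intros l. unfold c.
      pose proof (pos_INR l). pose proof (pos_INR n).
      assert (E : moment_term n (S l) = (2 * INR l + 1) ^ 3 * moment_term n l
        / ((2 * INR l + 2) * (2 * INR l + INR n + 2) * (2 * INR l + INR n + 3))).
      { rewrite <- moment_term_shift. field. lra. }
      rewrite E. cbn [moment_term]. rewrite !S_INR. field. lra.
    - simpl. ring.
    - replace (Finite 0) with (Rbar_mult (- 2 * (INR n + 1)) 0)
        by (simpl; f_equal; ring).
      apply is_lim_seq_scal_l, lim_mul_moment_term. }
  apply is_series_unique in H.
  rewrite Series_plus, Series_minus, !Series_scal_l in H.
  - unfold moment. lra.
  - apply (ex_series_scal_l _ (moment_term (S (S n)))), ex_series_moment_term.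
  - apply (ex_series_scal_l _ (moment_term (S n))), ex_series_moment_term.
  - apply (ex_series_minus (V := R_NormedModule)
       (fun l => (INR n + 2) ^ 2 * moment_term (S (S n)) l)
       (fun l => c * moment_term (S n) l)).
    + apply (ex_series_scal_l _ (moment_term (S (S n)))), ex_series_moment_term.
    + apply (ex_series_scal_l _ (moment_term (S n))), ex_series_moment_term.
  - apply (ex_series_scal_l _ (moment_term n)), ex_series_moment_term.
Qed.

(** * Evaluation of [moment 0] through Catalan's constant *)

(* fourier_term k l = (-1)^k h_l l!^2 / ((l-k)! (l+k)! (2l+1)); its sum over l is
   (2/pi) int_0^(pi/2) t cos(2kt) / sin t dt, and differencing the integral in k gives
   2 int_0^(pi/2) t sin((2k+1)t) dt = 2 (-1)^k / (2k+1)^2. *)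
Fixpoint fourier_term (k l : nat) : R :=
  match k with
  | O => moment_term O l
  | S j => - fourier_term j l * ((INR l - INR j) / (INR l + INR j + 1))
  end.

(** The factor with j = l is zero, which realises the convention 1/(l-k)! = 0. *)
Lemma fourier_term_0 (k l : nat) : (l < k)%nat -> fourier_term k l = 0.
Proof.
  induction k as [|k IH]; intros H; [lia|]. cbn [fourier_term].
  destruct (Nat.eq_dec l k) as [->|Hn].
  - unfold Rdiv. ring.
  - rewrite IH by lia. ring.
Qed.

Lemma fourier_term_le (k l : nat) : Rabs (fourier_term k l) <= moment_term O l.
Proof.
  induction k as [|k IH].
  - rewrite Rabs_pos_eq by (apply Rlt_le, (moment_term_pos O)). apply Rle_refl.
  - destruct (Nat.le_gt_cases k l) as [Hk|Hk].
    + cbn [fourier_term]. rewrite Rabs_mult, Rabs_Ropp.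
      apply le_INR in Hk. pose proof (pos_INR k).
      assert (0 <= (INR l - INR k) / (INR l + INR k + 1) <= 1).
      { split; [apply Rdiv_le_0_compat; lra|apply Rle_div_l; lra]. }
      rewrite (Rabs_pos_eq (_ / _)) by lra.
      pose proof (Rabs_pos (fourier_term k l)). nra.
    + rewrite fourier_term_0 by lia. rewrite Rabs_R0. apply Rlt_le, moment_term_pos.
Qed.

(** The ratio in l, kept free of division because l + 1 - k may vanish. *)
Lemma fourier_term_shift (k l : nat) :
  (INR l + 1 - INR k) * fourier_term k (S l) * 4 * (2 * INR l + 3) * (INR l + 1 + INR k)
  = (2 * INR l + 1) ^ 3 * fourier_term k l.
Proof.
  pose proof (pos_INR l).
  induction k as [|k IH].
  - cbn [fourier_term moment_term wallis_sq]. rewrite S_INR. simpl INR. field. lra.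
  - cbn [fourier_term]. rewrite !S_INR. pose proof (pos_INR k).
    transitivity (- ((INR l - INR k) / (INR l + INR k + 1)) *
      ((INR l + 1 - INR k) * fourier_term k (S l) * 4 * (2 * INR l + 3) * (INR l + 1 + INR k))).
    + field. lra.
    + rewrite IH. field. lra.
Qed.

(** Passing from k to k+1 multiplies the sequence by -(l-k-1)/(l+k+1), which tends to -1; for k = 0
    it is half of [2 * INR l * wallis_sq l]. *)
Lemma fourier_term_lim (k : nat) :
  is_lim_seq (fun l => (INR l - INR k) * (2 * INR l + 1) * fourier_term k l)
             ((-1) ^ k * (wallis_lim / 2)).
Proof.
  induction k as [|k IH].
  - apply is_lim_seq_ext with (fun l => / 2 * (2 * INR l * wallis_sq l)).
    + intros l. simpl. pose proof (pos_INR l). field. lra.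
    + replace (Finite ((-1) ^ 0 * (wallis_lim / 2)))
        with (Rbar_mult (/ 2) wallis_lim) by (simpl; f_equal; field).
      apply is_lim_seq_scal_l, wallis_sq_lim.
  - apply is_lim_seq_ext with (fun l =>
      (-1) * ((INR l - INR k) * (2 * INR l + 1) * fourier_term k l)
      * (1 - (2 * INR k + 2) * / (INR l + INR k + 1))).
    + intros l. cbn [fourier_term]. rewrite S_INR.
      pose proof (pos_INR l). pose proof (pos_INR k). field. lra.
    + replace (Finite ((-1) ^ S k * (wallis_lim / 2)))
        with (Finite ((-1) * ((-1) ^ k * (wallis_lim / 2)) * (1 - (2 * INR k + 2) * 0)))
        by (f_equal; simpl; ring).
      apply is_lim_seq_mult'.
      * apply is_lim_seq_mult'; [apply is_lim_seq_const|exact IH].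
      * apply is_lim_seq_minus'; [apply is_lim_seq_const|].
        apply is_lim_seq_mult'; [apply is_lim_seq_const|].
        apply is_lim_seq_ext with (fun l => / INR (l + (k + 1))).
        { intros l. rewrite !plus_INR. f_equal. simpl. ring. }
        apply (is_lim_seq_incr_n (fun l => / INR l) (k + 1) 0).
        replace (Finite 0) with (Rbar_inv p_infty) by reflexivity.
        apply is_lim_seq_inv; [apply is_lim_seq_INR|discriminate].
Qed.

Lemma ex_series_fourier_term (k : nat) : ex_series (fourier_term k).
Proof.
  apply (ex_series_le (K := R_AbsRing) (V := R_CompleteNormedModule)
           _ (moment_term O)); [|apply ex_series_moment_term_0].
  intros l. apply (fourier_term_le k l).
Qed.

(** A WZ pair whose certificate does not vanish at infinity: its limit there, from
    [fourier_term_lim], is the summand of Catalan's series. *)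
Lemma fourier_step (k : nat) :
  Series (fourier_term k) - Series (fourier_term (S k)) =
  2 * wallis_lim * ((-1) ^ k / (2 * INR k + 1) ^ 2).
Proof.
  rewrite <- Series_minus by apply ex_series_fourier_term.
  apply is_series_unique.
  pose proof (pos_INR k) as Hk.
  apply (is_series_telescope _ (fun l => 4 / (2 * INR k + 1) ^ 2 *
           ((INR l - INR k) * (2 * INR l + 1) * fourier_term k l))).
  - intros l. pose proof (pos_INR l).
    pose proof (fourier_term_shift k l) as E.
    cbn [fourier_term]. rewrite S_INR.
    replace ((INR l + 1 - INR k) * (2 * (INR l + 1) + 1) * fourier_term k (S l))
      with ((2 * INR l + 1) ^ 3 * fourier_term k l / (4 * (INR l + 1 + INR k)))
      by (rewrite <- E; field; lra).
    field. lra.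
  - destruct k as [|k].
    + simpl. ring.
    + rewrite fourier_term_0 by lia. ring.
  - replace (Finite (2 * wallis_lim * ((-1) ^ k / (2 * INR k + 1) ^ 2)))
      with (Rbar_mult (4 / (2 * INR k + 1) ^ 2) ((-1) ^ k * (wallis_lim / 2)))
      by (simpl; f_equal; field; lra).
    apply is_lim_seq_scal_l, fourier_term_lim.
Qed.

(** A discrete Riemann-Lebesgue lemma: terms with l <= k are zero, so the sum is dominated by a tail
    of the convergent series [moment 0]. *)
Lemma fourier_lim : is_lim_seq (fun k => Series (fourier_term (S k))) 0.
Proof.
  apply is_lim_seq_abs_0.
  apply is_lim_seq_le_le with (fun _ => 0)
    (fun k => moment O - sum_n (moment_term O) k).
  - intros k. split; [apply Rabs_pos|].
    rewrite (Series_incr_n (fourier_term (S k)) (S k)); [|lia|apply ex_series_fourier_term].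
    unfold moment.
    rewrite (Series_incr_n (moment_term O) (S k)); [|lia|apply ex_series_moment_term].
    rewrite <- !sum_n_Reals. simpl pred.
    replace (sum_n (fourier_term (S k)) k) with 0.
    + rewrite Rplus_0_l.
      replace (sum_n (moment_term O) k + Series (fun l => moment_term O (S k + l))
               - sum_n (moment_term O) k)
        with (Series (fun l => moment_term O (S k + l))) by ring.
      assert (Hs : ex_series (fun l => moment_term O (S k + l))).
      { apply (ex_series_incr_n (moment_term O)), ex_series_moment_term. }
      eapply Rle_trans.
      * apply Series_Rabs.
        apply (ex_series_le (K := R_AbsRing) (V := R_CompleteNormedModule)
                 _ (fun l => moment_term O (S k + l))); [|exact Hs].
        intros l. change (Rabs (Rabs (fourier_term (S k) (S k + l))) <= moment_term O (S k + l)).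
        rewrite Rabs_Rabsolu. apply fourier_term_le.
      * apply Series_le; [|exact Hs].
        intros l. split; [apply Rabs_pos|apply fourier_term_le].
    + rewrite (sum_n_ext_loc _ (fun _ => 0)).
      * rewrite sum_n_const. ring.
      * intros l Hl. apply fourier_term_0. lia.
  - apply is_lim_seq_const.
  - replace (Finite 0) with (Finite (moment O - moment O)) by (f_equal; ring).
    apply is_lim_seq_minus'; [apply is_lim_seq_const|].
    apply (Series_correct _ (ex_series_moment_term O)).
Qed.

(** Summing [fourier_step] over k telescopes from [moment 0], the case k = 0, down to the limit
    0. *)
Lemma moment_0 : moment O = 2 * wallis_lim * Catalan.
Proof.
  pose proof wallis_lim_pos as Hw.
  assert (H : is_series (fun k => (-1) ^ k / (2 * INR k + 1) ^ 2)
                (moment O / (2 * wallis_lim))).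
  { apply (is_series_telescope _ (fun k =>
      (moment O - Series (fourier_term k)) / (2 * wallis_lim))).
    - intros k.
      replace ((moment O - Series (fourier_term (S k))) / (2 * wallis_lim) -
               (moment O - Series (fourier_term k)) / (2 * wallis_lim))
        with ((Series (fourier_term k) - Series (fourier_term (S k))) / (2 * wallis_lim))
        by (field; lra).
      rewrite fourier_step. pose proof (pos_INR k). field. lra.
    - change (Series (fourier_term 0)) with (moment 0). unfold Rdiv. ring.
    - apply (is_lim_seq_incr_1 (fun k =>
        (moment O - Series (fourier_term k)) / (2 * wallis_lim))).
      replace (moment O / (2 * wallis_lim))
        with ((moment O - 0) * / (2 * wallis_lim)) by (field; lra).
      apply is_lim_seq_mult'; [|apply is_lim_seq_const].
      apply is_lim_seq_minus'; [apply is_lim_seq_const|apply fourier_lim]. }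
  unfold Catalan. rewrite (is_series_unique _ _ H). field. lra.
Qed.

(** * The linear form in numerators and denominators of the convergents *)

Definition cf_a (n : nat) : R := 3 * INR n ^ 2 + 15 * INR n + 19.
Definition cf_b (n : nat) : R := - 2 * INR n * (INR n + 2) ^ 3.

Lemma CF_num_SS (a b : nat -> R) (n : nat) :
  CF_num a b (S (S n)) = a (S n) * CF_num a b (S n) + b (S n) * CF_num a b n.
Proof. reflexivity. Qed.

Lemma CF_den_SS (a b : nat -> R) (n : nat) :
  CF_den a b (S (S n)) = a (S n) * CF_den a b (S n) + b (S n) * CF_den a b n.
Proof. reflexivity. Qed.

(* The two quartics were found by solving for the coefficients of v_n and
   v_(n+1) in (54 G - 49) A_n - 8 B_n for small n and interpolating. *)
Definition remainder (n : nat) : R :=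
  INR (fact (S n)) ^ 2 *
  ((INR n ^ 4 + 14 * INR n ^ 3 + 58 * INR n ^ 2 + 91 * INR n + 49) * moment (S n)
   - (INR n ^ 4 + 13 * INR n ^ 3 + 46 * INR n ^ 2 + 56 * INR n + 22) * moment n).

Lemma INR_fact_S (n : nat) : INR (fact (S n)) = (INR n + 1) * INR (fact n).
Proof. rewrite fact_simpl, mult_INR, S_INR. reflexivity. Qed.

Lemma remainder_rec (n : nat) :
  remainder (S (S n)) = cf_a (S n) * remainder (S n) + cf_b (S n) * remainder n.
Proof.
  unfold remainder, cf_a, cf_b.
  pose proof (moment_rec n) as H1. pose proof (moment_rec (S n)) as H2.
  rewrite !INR_fact_S. rewrite !S_INR in *.
  pose proof (pos_INR n) as Hn.
  (* Eliminating the outer moments n and n+3 leaves the moments n+1 and n+2, whose coefficients must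
     agree. *)
  assert (E1 : moment n = ((3 * (INR n + 1) ^ 2 + 3 * (INR n + 1) + 1) * moment (S n)
     - (INR n + 2) ^ 2 * moment (S (S n))) / (2 * (INR n + 1) ^ 2)).
  { rewrite H1. field. lra. }
  assert (E2 : moment (S (S (S n))) =
     ((3 * (INR n + 1 + 1) ^ 2 + 3 * (INR n + 1 + 1) + 1) * moment (S (S n))
     - 2 * (INR n + 1 + 1) ^ 2 * moment (S n)) / (INR n + 1 + 2) ^ 2).
  { rewrite <- H2. field. lra. }
  rewrite E1, E2. field. lra.
Qed.

(** Both sides obey the same second-order recurrence, so ranks 0 and 1 suffice. Rank 0 reads 49 v_1
    - 22 v_0 = 27 v_0 - 49 with v_0 = 2G, whence 54 G - 49. *)
Lemma remainder_CF (n : nat) :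
  remainder n = wallis_lim *
    ((54 * Catalan - 49) * CF_num cf_a cf_b n - 8 * CF_den cf_a cf_b n).
Proof.
  enough (H : remainder n = wallis_lim *
      ((54 * Catalan - 49) * CF_num cf_a cf_b n - 8 * CF_den cf_a cf_b n) /\
    remainder (S n) = wallis_lim *
      ((54 * Catalan - 49) * CF_num cf_a cf_b (S n) - 8 * CF_den cf_a cf_b (S n)))
    by apply H.
  induction n as [|n [IH1 IH2]].
  - pose proof (moment_rec 0) as H. simpl INR in H.
    assert (E : moment 2 = (7 * moment 1 - 2 * moment 0) / 4) by lra.
    unfold remainder, cf_a. rewrite E, moment_1, moment_0. simpl. split; field.
  - split; [exact IH2|].
    rewrite remainder_rec, IH1, IH2, CF_num_SS, CF_den_SS. ring.
Qed.

(** * Growth of the denominators against the size of the remainder *)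

(** After scaling by n^2 the recurrence has characteristic equation x^2 = 3x - 2, with roots 1 and
    2. A ratio bound r strictly between them is preserved, as 3 - 2/r > r; here r = 3/2. Since
    [cf_b] is negative for n >= 1, positivity relies on this bound. *)
Lemma CF_den_growth (n : nat) :
  0 < CF_den cf_a cf_b (S n) /\
  3 / 2 * (INR n + 4) ^ 2 * CF_den cf_a cf_b (S n) <= CF_den cf_a cf_b (S (S n)).
Proof.
  induction n as [|n [IH1 IH2]].
  - simpl. unfold cf_a, cf_b. simpl. lra.
  - pose proof (pos_INR n) as Hn. split.
    + eapply Rlt_le_trans; [|exact IH2].
      apply Rmult_lt_0_compat; [nra|exact IH1].
    + rewrite (CF_den_SS _ _ (S n)).
      set (D := CF_den cf_a cf_b (S n)) in *.
      set (D' := CF_den cf_a cf_b (S (S n))) in *.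
      unfold cf_a, cf_b. rewrite !S_INR.
      assert (H : 2 * (INR n + 2) * (INR n + 4) ^ 3 * D
                  <= 4 / 3 * (INR n + 2) * (INR n + 4) * D').
      { replace (2 * (INR n + 2) * (INR n + 4) ^ 3 * D)
          with (4 / 3 * (INR n + 2) * (INR n + 4) * (3 / 2 * (INR n + 4) ^ 2 * D))
          by field.
        apply Rmult_le_compat_l; [nra|exact IH2]. }
      assert (HD' : 0 < D').
      { eapply Rlt_le_trans; [|exact IH2].
        apply Rmult_lt_0_compat; [nra|exact IH1]. }
      replace (INR n + 1 + 1) with (INR n + 2) by ring.
      replace (INR n + 2 + 2) with (INR n + 4) by ring.
      (* The leading coefficient is 3 - 4/3 - 3/2 = 1/6. *)
      assert (0 <= (3 * (INR n + 2) ^ 2 + 15 * (INR n + 2) + 19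
                    - 4 / 3 * (INR n + 2) * (INR n + 4)
                    - 3 / 2 * (INR n + 1 + 4) ^ 2) * D').
      { apply Rmult_le_pos; [nra|lra]. }
      lra.
Qed.

(** The growth factor 3/2 left beside the factorials absorbs a cubic; the shift 10 makes this work
    from n = 0, as (11/10)^3 < 3/2. The constant is 3!^2 * 10^3, for n = 0. *)
Lemma CF_den_lower (n : nat) :
  INR (fact (S (S (S n)))) ^ 2 * (INR n + 10) ^ 3
  <= 36000 * CF_den cf_a cf_b (S n).
Proof.
  induction n as [|n IH].
  - simpl. lra.
  - destruct (CF_den_growth n) as [H1 H2].
    rewrite (INR_fact_S (S (S (S n)))). rewrite !S_INR.
    pose proof (pos_INR n) as Hn.
    set (f := INR (fact (S (S (S n))))) in *.
    apply Rle_trans with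
      (3 / 2 * (INR n + 4) ^ 2 * (f ^ 2 * (INR n + 10) ^ 3)).
    + assert (Hc : (INR n + 1 + 10) ^ 3 <= 3 / 2 * (INR n + 10) ^ 3).
      { assert (0 <= INR n ^ 2) by (apply pow_le; lra).
        assert (0 <= INR n ^ 3) by (apply pow_le; lra). lra. }
      replace (((INR n + 1 + 1 + 1 + 1) * f) ^ 2 * (INR n + 1 + 10) ^ 3)
        with (((INR n + 4) ^ 2 * f ^ 2) * (INR n + 1 + 10) ^ 3) by ring.
      replace (3 / 2 * (INR n + 4) ^ 2 * (f ^ 2 * (INR n + 10) ^ 3))
        with (((INR n + 4) ^ 2 * f ^ 2) * (3 / 2 * (INR n + 10) ^ 3)) by ring.
      apply Rmult_le_compat_l; [|exact Hc].
      apply Rmult_le_pos; apply pow2_ge_0.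
    + apply Rle_trans with
        (3 / 2 * (INR n + 4) ^ 2 * (36000 * CF_den cf_a cf_b (S n))); [|lra].
      apply Rmult_le_compat_l; [nra|exact IH].
Qed.

(** Both quartics lie between 0 and 4(n+2)^4 and both moments between 0 and [moment 0]; a difference
    of two such products costs no factor 2. *)
Lemma remainder_le (n : nat) :
  Rabs (remainder n) <= INR (fact (S n)) ^ 2 * (4 * (INR n + 2) ^ 4 * moment O).
Proof.
  unfold remainder. rewrite Rabs_mult, (Rabs_pos_eq (_ ^ 2)) by apply pow2_ge_0.
  apply Rmult_le_compat_l; [apply pow2_ge_0|].
  pose proof (pos_INR n) as Hn.
  assert (0 <= INR n ^ 2) by nra. assert (0 <= INR n ^ 3) by (apply pow_le; lra).
  assert (0 <= INR n ^ 4) by (apply pow_le; lra).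
  set (p := _ + 49). set (q := _ + 22). set (r := 4 * _).
  assert (0 <= p <= r) by (unfold p, r; split; [lra|nra]).
  assert (0 <= q <= r) by (unfold q, r; split; [lra|nra]).
  pose proof (moment_nonneg n). pose proof (moment_nonneg (S n)).
  pose proof (moment_le_0 n). pose proof (moment_le_0 (S n)).
  apply Rabs_le. split; nra.
Qed.

Lemma remainder_div_lim :
  is_lim_seq (fun n => remainder n / CF_den cf_a cf_b n) 0.
Proof.
  apply is_lim_seq_incr_1, is_lim_seq_abs_0.
  apply is_lim_seq_le_le with (fun _ => 0)
    (* 144000 = 4 * 36000 from the two bounds; the rest is (n+3)^2/(n+10)^3 <= 1/(n+1). *)
    (fun n => 144000 * moment O * / INR (S n)).
  - intros n. split; [apply Rabs_pos|].
    destruct (CF_den_growth n) as [HD _].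
    pose proof (CF_den_lower n) as HL. pose proof (remainder_le (S n)) as HR.
    pose proof (pos_INR n) as Hn. pose proof (moment_nonneg 0) as HM.
    set (D := CF_den cf_a cf_b (S n)) in *.
    rewrite (INR_fact_S (S (S n))) in HL. rewrite !S_INR in *.
    set (f := INR (fact (S (S n)))) in *.
    unfold Rdiv. rewrite Rabs_mult, Rabs_inv, (Rabs_pos_eq D) by lra.
    apply Rle_div_l; [exact HD|].
    eapply Rle_trans; [exact HR|].
    apply Rle_trans with
      (4 * moment 0 * / (INR n + 1) *
        (((INR n + 1 + 1 + 1) * f) ^ 2 * (INR n + 10) ^ 3)).
    + replace (f ^ 2 * (4 * (INR n + 1 + 2) ^ 4 * moment 0))
        with (4 * moment 0 * (INR n + 3) ^ 2 * f ^ 2 * (INR n + 3) ^ 2) by ring.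
      replace (4 * moment 0 * / (INR n + 1) *
          (((INR n + 1 + 1 + 1) * f) ^ 2 * (INR n + 10) ^ 3))
        with (4 * moment 0 * (INR n + 3) ^ 2 * f ^ 2 * ((INR n + 10) ^ 3 / (INR n + 1)))
        by (field; lra).
      apply Rmult_le_compat_l.
      * apply Rmult_le_pos; [apply Rmult_le_pos; [lra|]|]; apply pow2_ge_0.
      * apply (Rle_div_r ((INR n + 3) ^ 2)); [lra|].
        assert (0 <= INR n ^ 2) by nra. assert (0 <= INR n ^ 3) by (apply pow_le; lra).
        lra.
    + replace (144000 * moment 0 * / (INR n + 1) * D)
        with (4 * moment 0 * / (INR n + 1) * (36000 * D)) by ring.
      apply Rmult_le_compat_l; [|exact HL].
      apply Rmult_le_pos; [lra|]. apply Rlt_le, Rinv_0_lt_compat. lra.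
  - apply is_lim_seq_const.
  - replace (Finite 0) with (Finite (144000 * moment O * 0)) by (f_equal; ring).
    apply is_lim_seq_mult'; [apply is_lim_seq_const|].
    apply (is_lim_seq_incr_1 (fun n => / INR n) 0).
    replace (Finite 0) with (Rbar_inv p_infty) by reflexivity.
    apply is_lim_seq_inv; [apply is_lim_seq_INR|discriminate].
Qed.

(** * Value of the continued fraction *)

Theorem corollary2p21 :
  is_CF (fun n : nat => 3 * INR n ^ 2 + 15 * INR n + 19)
        (fun n : nat => - 2 * INR n * (INR n + 2) ^ 3)
        (8 / (54 * Catalan - 49)).
Proof.
  change (is_CF cf_a cf_b (8 / (54 * Catalan - 49))).
  pose proof wallis_lim_pos as Hw.
  assert (HD : forall n, (1 <= n)%nat -> 0 < CF_den cf_a cf_b n).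
  { intros [|n] Hn; [lia|]. apply CF_den_growth. }
  (* Otherwise [remainder_CF] makes remainder over denominator the nonzero constant
     [- 8 * wallis_lim], against its limit 0. *)
  assert (Hs : 54 * Catalan - 49 <> 0).
  { intros Hs.
    assert (H : is_lim_seq (fun n => remainder n / CF_den cf_a cf_b n) (- 8 * wallis_lim)).
    { apply is_lim_seq_ext_loc with (fun _ => - 8 * wallis_lim).
      - exists 1%nat. intros n Hn. apply HD in Hn.
        rewrite remainder_CF, Hs. field. lra.
      - apply is_lim_seq_const. }
    apply is_lim_seq_unique in H. rewrite (is_lim_seq_unique _ _ remainder_div_lim) in H.
    injection H. lra. }
  split.
  - exists 1%nat. intros n Hn. apply HD in Hn. lra.
  - set (s := 54 * Catalan - 49) in *.
    (* This is [remainder_CF] solved for the convergent. *)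
    apply is_lim_seq_ext_loc with (fun n =>
      8 / s + / (wallis_lim * s) * (remainder n / CF_den cf_a cf_b n)).
    + exists 1%nat. intros n Hn. apply HD in Hn.
      rewrite remainder_CF. fold s. field. repeat split; lra.
    + replace (Finite (8 / s)) with (Finite (8 / s + / (wallis_lim * s) * 0))
        by (f_equal; ring).
      apply is_lim_seq_plus'; [apply is_lim_seq_const|].
      apply is_lim_seq_mult'; [apply is_lim_seq_const|apply remainder_div_lim].
Qed.
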